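(* Let $\mathcal{M}$ be a collection of $3$ lines in general linear position in $\mathbb{P}^4$, and let $R=S/J$ be the coordinate ring of $\mathcal{M}$, where $S=\mathbb{C}[x_0,\ldots,x_4]$ and $J$ is the defining ideal of $\mathcal{M}$. Then $J$ has a cubic form in a minimal generating set. Hence $R$ is not Koszul.
   Context: Let $\mathbb{P}^n$ be projective $n$-space over $\mathbb{C}$ with homogeneous coordinate ring $S=\mathbb{C}[x_0,\ldots,x_n]$ (standard grading). The defining ideal of a line in $\mathbb{P}^n$ is the ideal of $S$ of all forms vanishing on it. For a collection $\mathcal{M}=\{\mathcal{L}_1,\ldots,\mathcal{L}_m\}$ of lines with defining ideals $L_1,\ldots,L_m$, the defining ideal of $\mathcal{M}$ is $J=\bigcap_{i=1}^m L_i$ and the coordinate ring of $\mathcal{M}$ is $R=S/J$. The lines of $\mathcal{M}$ are in general linear position if any $s$ of the lines span a $\mathbb{P}^r$ with $r=\min\{2s-1,n\}$. Minimal generating sets are taken to consist of homogeneous elements. A standard graded $\mathbb{C}$-algebra $R$ is Koszul if $\mathbb{C}=R/\mathfrak{m}_R$ (with $\mathfrak{m}_R$ the maximal homogeneous ideal) has a linear free resolution over $R$, i.e. $\mathrm{Tor}_i^R(\mathbb{C},\mathbb{C})_j=0$ for all $i\neq j$. *)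

(* Defs.v *)
From HB Require Import structures.
From mathcomp Require Import all_boot all_order all_algebra ring_quotient.
From mathcomp Require Import mpoly.
From mathcomp Require Import boolp classical_sets.

Set Implicit Arguments.
Unset Strict Implicit.
Unset Printing Implicit Defensive.

Import GRing.Theory.

Local Open Scope ring_scope.
Local Open Scope quotient_scope.
Local Open Scope classical_set_scope.

Section Ideals.
Variable A : comNzRingType.

Definition ideal_gen (G : set A) : set A :=
  [set a | exists k (c g : 'I_k -> A),
      (forall i, G (g i)) /\ a = \sum_(i < k) c i * g i].

Lemma ideal_gen0 (G : set A) : ideal_gen G 0.
Proof. by exists 0%N, (fun _ => 0), (fun _ => 0); split=> [[]|]; rewrite ?big_ord0. Qed.

Lemma ideal_genM (G : set A) a x : ideal_gen G x -> ideal_gen G (a * x).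
Proof.
move=> [k [c [g [Gg ->]]]]; exists k, (fun i => a * c i), g; split=> //.
by rewrite mulr_sumr; apply: eq_bigr => i _; rewrite mulrA.
Qed.

Lemma ideal_genD (G : set A) x y :
  ideal_gen G x -> ideal_gen G y -> ideal_gen G (x + y).
Proof.
move=> [k [c [g [Gg ->]]]] [l [c' [g' [Gg' ->]]]].
exists (k + l)%N,
  (fun i => match split i with inl j => c j | inr j => c' j end),
  (fun i => match split i with inl j => g j | inr j => g' j end).
split=> [i|]; first by case: (split i).
rewrite big_split_ord /=; congr (_ + _); apply: eq_bigr => i _.
  by case: splitP => j Hj; [congr (c _ * g _); apply: val_inj
    | move: (ltn_ord i); rewrite [X in (X < _)%N]Hj ltnNge leq_addr].
case: splitP => j Hj; last by
  congr (c' _ * g' _); apply: val_inj; apply: (@addnI k); exact: Hj.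
by move: (ltn_ord j); rewrite -Hj ltnNge leq_addr.
Qed.

(* [gr d] is the set of elements of degree d, zero included. *)
Definition irrelevant_ideal (gr : nat -> set A) : set A :=
  ideal_gen (\bigcup_(d in [set d | (0 < d)%N]) gr d).

(* For A a standard graded algebra over the field A_0: existence of a linear
   free resolution
     ... -> A(-2)^(b 2) -> A(-1)^(b 1) -> A^(b 0) -> A / m -> 0
   of the residue field, m being the irrelevant ideal.  Free modules are row
   vectors with maps acting on the right; that the differentials have degree 0
   says exactly that the entries of their matrices d i are in A_1.  The
   augmentation sends the j-th basis vector to the class of e j 0 modulo m. *)
Definition koszul (gr : nat -> set A) : Prop :=
  let m := irrelevant_ideal gr in
  exists (b : nat -> nat) (e : 'cV[A]_(b 0%N))
         (d : forall i, 'M[A]_(b i.+1, b i)),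
  [/\ forall i j k, gr 1%N (d i j k),
      forall a : A, exists v : 'rV[A]_(b 0%N), m (a - (v *m e) 0 0),
      forall v : 'rV[A]_(b 0%N),
        m ((v *m e) 0 0) <-> exists w, v = w *m d 0%N
    & forall i (v : 'rV[A]_(b i.+1)),
        v *m d i = 0 <-> exists w, v = w *m d i.+1].

End Ideals.

Section Lines.
Variables (F : fieldType) (n : nat).

(* A line of P^n, seen as a 2-dimensional subspace of F^(n+1); the points of
   the line are the classes of the nonzero vectors of that subspace. *)
Record line := Line {
  line_space :> {vspace 'rV[F]_n.+1};
  dim_line : \dim line_space = 2%N }.

Definition vanishes_on (L : line) (p : {mpoly F[n.+1]}) : Prop :=
  forall v : 'rV[F]_n.+1, v != 0 -> v \in line_space L ->
    p.@[fun i => v 0 i] = 0.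

Definition line_ideal (L : line) : set {mpoly F[n.+1]} :=
  ideal_gen [set p | (exists d : nat, p \is d.-homog) /\ vanishes_on L p].

Lemma line_ideal_vanishes (L : line) p : line_ideal L p -> vanishes_on L p.
Proof.
move=> [k [c [g [Gg ->]]]] v v0 vL.
rewrite raddf_sum big1 //= => i _.
by rewrite mevalM (Gg i).2 ?mulr0.
Qed.

Lemma line_ideal1 (L : line) : ~ line_ideal L 1.
Proof.
move/line_ideal_vanishes => H.
have v0 : vpick L != 0 by rewrite vpick0 -dimv_eq0 dim_line.
by have /eqP := H _ v0 (memv_pick L); rewrite meval1 oner_eq0.
Qed.

Variable m : nat.

Definition general_linear_position (M : 'I_m.+1 -> line) : Prop :=
  forall A : {set 'I_m.+1}, A != finset.set0 ->
    \dim (\sum_(i in A) line_space (M i))%VS = (minn (2 * #|A| - 1) n).+1.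

Definition defining_ideal (M : 'I_m.+1 -> line) : {pred {mpoly F[n.+1]}} :=
  fun p => `[< forall i, line_ideal (M i) p >].

Lemma defining_ideal_closed M : idealr_closed (defining_ideal M).
Proof.
split=> [|| a u v /asboolP Iu /asboolP Iv]; first exact/asboolP/(fun _ => ideal_gen0 _).
  by apply/negP => /asboolP /(_ ord0) /line_ideal1.
apply/asboolP => i; apply: ideal_genD; last exact: Iv.
by apply: ideal_genM; exact: Iu.
Qed.

HB.instance Definition _ M :=
  isIdealr.Build {mpoly F[n.+1]} (defining_ideal M) (defining_ideal_closed M).

Definition coordinate_ring (M : 'I_m.+1 -> line) : comNzRingType :=
  {ideal_quot defining_ideal M}.

Definition coordinate_grading (M : 'I_m.+1 -> line) :
    nat -> set (coordinate_ring M) :=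
  fun d => [set x | exists2 p : {mpoly F[n.+1]},
                 p \is d.-homog & x = \pi_{ideal_quot defining_ideal M} p].

End Lines.

Arguments coordinate_grading {F n m} M _ _.

Definition minimal_generating_set (F : fieldType) (n : nat)
    (J G : set {mpoly F[n]}) : Prop :=
  [/\ forall g, G g -> exists d : nat, g \is d.-homog,
      ideal_gen G = J
    & forall H : set {mpoly F[n]}, H `<=` G -> ideal_gen H = J -> H = G].

(* Main.v *)
(* Choose a basis e0, ..., e4 of the ambient space for which the lines are the
   spans <e0, e1>, <e2, e3> and <e0 + e2, e4>, and let y0, ..., y4 be the dual
   linear forms. The ideal of the three lines is generated by the six quadrics
   y4 y1, y4 y3, y4 (y0 - y2), y0 y3, y1 y2, y1 y3 and by the cubic
   y0 y2 (y0 - y2). The line <e0, e2> meets the three given lines, so the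
   quadrics vanish on it while the cubic does not; hence every minimal subset of
   these seven generators contains the cubic. If the coordinate ring had a linear
   resolution of its residue field, then, lifting the first two differentials to
   polynomials, the cubic would be a combination of quadrics of the ideal up to
   terms that vanish to order at least 4 at the origin along <e0 - e2>, which
   contradicts its value there. *)
From HB Require Import structures.
Require Import Defs.
From mathcomp Require Import all_boot all_order all_algebra ring_quotient.
From mathcomp Require Import mpoly complex ring.
From mathcomp Require Import boolp classical_sets reals.

Set Implicit Arguments.
Unset Strict Implicit.
Unset Printing Implicit Defensive.

Import GRing.Theory Num.Theory.

Local Open Scope ring_scope.
Local Open Scope complex_scope.
Local Open Scope quotient_scope.
Local Open Scope classical_set_scope.

(** * Polynomials that vanish at all points *)

Section ZeroTest.
Variable F : numFieldType.

(** In characteristic 0 the points 1, ..., [size p] are distinct and nonzero, and a nonzero [p] has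
    fewer than [size p] roots. *)
Lemma poly_eq0_of_horner (p : {poly F}) : (forall c, c != 0 -> p.[c] = 0) -> p = 0.
Proof.
move=> p0; apply/eqP; apply/negPn/negP => pn0.
pose s : seq F := [seq k.+1%:R | k <- iota 0 (size p)].
have us : uniq s.
  by rewrite map_inj_uniq ?iota_uniq // => i j /eqP; rewrite eqr_nat => /eqP[].
have rs : all (root p) s.
  by apply/allP => _ /mapP[k _ ->]; apply/rootP/p0; rewrite pnatr_eq0.
by have := max_poly_roots pn0 rs us; rewrite size_map size_iota ltnn.
Qed.

Lemma digits_inj n N (a b : 'I_n -> nat) :
  (forall i, a i < N)%N -> (forall i, b i < N)%N ->
  (\sum_i a i * N ^ i = \sum_i b i * N ^ i)%N -> a =1 b.
Proof.
elim: n a b => [|n IH] a b aN bN; first by move=> _ [].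
have low (c : 'I_n.+1 -> nat) :
    (\sum_i c i * N ^ i = (\sum_(i < n) c (lift ord0 i) * N ^ i) * N + c ord0)%N.
  rewrite big_ord_recl /= expn0 muln1 addnC big_distrl /=; congr (_ + _)%N.
  by apply: eq_bigr => i _; rewrite -mulnA -expnSr.
rewrite !low => E.
have N0 : (0 < N)%N by apply: leq_ltn_trans (aN ord0).
have E0 : a ord0 = b ord0.
  by have := congr1 (modn^~ N) E; rewrite !modnMDl !modn_small.
move: E; rewrite E0 => /addIn /eqP; rewrite eqn_pmul2r // => /eqP E i.
case: (unliftP ord0 i) => [j ->|-> //].
exact: (IH (fun j => a (lift ord0 j)) (fun j => b (lift ord0 j))).
Qed.

(* Kronecker substitution ['X_i := 'X ^ (N ^ i)], which separates monomials for
   large [N], reduces the question to one variable. *)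
Lemma mpoly_eq0_of_meval n (p : {mpoly F[n]}) :
  (forall v : 'rV_n, p.@[fun i => v 0 i] = 0) -> p = 0.
Proof.
move=> p0; set N := msize p.
pose enc (m : 'X_{1..n}) := (\sum_i m i * N ^ i)%N.
pose q : {poly F} := \sum_(m <- msupp p) p@_m *: 'X^(enc m).
have q0 : q = 0.
  apply: poly_eq0_of_horner => c _.
  have := p0 (\row_i c ^+ (N ^ i)); rewrite mevalE => <-; rewrite horner_sum.
  apply: eq_bigr => m _; rewrite hornerZ hornerXn; congr (_ * _).
  rewrite expr_sum; apply: eq_bigr => i _.
  by rewrite mxE mulnC exprM.
apply/mpolyP => m; rewrite mcoeff0.
have [mp|/memN_msupp_eq0 //] := boolP (m \in msupp p).
(* Exponents are bounded by the degree, hence are valid digits in base [N], and [enc] is injective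
   on the support of [p]. *)
have lt_digit m' (i : 'I_n) : m' \in msupp p -> (m' i < N)%N.
  move=> /msize_mdeg_lt; apply: leq_ltn_trans.
  by rewrite mdegE (bigD1 i) //= leq_addr.
have := congr1 (fun q : {poly F} => q`_(enc m)) q0.
rewrite coef0 coef_sum (bigD1_seq m) ?msupp_uniq //= coefZ coefXn eqxx mulr1.
rewrite big_seq_cond big1 ?addr0 // => m' /andP[m'p m'm].
rewrite coefZ coefXn; case: eqP => [E|_]; last by rewrite mulr0.
case/eqP: m'm; apply/mnmP => i.
by apply: (@digits_inj _ N m' m) => // [j|j]; apply: lt_digit.
Qed.

End ZeroTest.

(** * Linear forms dual to a basis, and substitutions in them *)

Section Coordinates.
Variables (F : fieldType) (n : nat) (B : 'M[F]_n).
Hypothesis Bu : B \in unitmx.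

(** The basis consists of the rows of [B], so [c *m B] has coordinates [c]; this is the [k]-th form
    of the dual basis. *)
Definition coord_form (k : 'I_n) : {mpoly F[n]} :=
  \sum_i invmx B i k *: 'X_i.

Lemma coord_form_homog k : coord_form k \is 1.-homog.
Proof. by apply: rpred_sum => i _; apply: rpredZ; rewrite dhomogX /= mdeg1. Qed.

Lemma meval_coord_form (c : 'rV[F]_n) k :
  (coord_form k).@[fun i => (c *m B) 0 i] = c 0 k.
Proof.
rewrite -[in RHS](mulmxK Bu c) mxE raddf_sum /=.
by apply: eq_bigr => i _; rewrite mevalZ mevalXU mulrC.
Qed.

Lemma mpolyX_coord_form i : 'X_i = \sum_k B k i *: coord_form k.
Proof.
under eq_bigr do rewrite scaler_sumr.
rewrite exchange_big /= (bigD1 i) //= -[LHS]addr0; congr (_ + _).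
  under eq_bigr do rewrite scalerA mulrC.
  rewrite -scaler_suml; have := mulVmx Bu => /matrixP/(_ i i).
  by rewrite !mxE eqxx => ->; rewrite scale1r.
rewrite big1 // => j ji; under eq_bigr do rewrite scalerA mulrC.
rewrite -scaler_suml; have := mulVmx Bu => /matrixP/(_ j i).
by rewrite !mxE (negbTE ji) => ->; rewrite scale0r.
Qed.

Variable T : comNzRingType.

(** The ring morphism that extends [h] and sends the [k]-th dual form to [z k]. *)
Definition subst_coord (h : {rmorphism F -> T}) (z : 'I_n -> T) :
    {mpoly F[n]} -> T :=
  mmap h (fun i => \sum_k h (B k i) * z k).

HB.instance Definition _ h z := GRing.RMorphism.on (subst_coord h z).

Lemma subst_coordC h z c : subst_coord h z c%:MP = h c.
Proof. exact: mmapC. Qed.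

Lemma subst_coordZ h z c p : subst_coord h z (c *: p) = h c * subst_coord h z p.
Proof. exact: mmapZ. Qed.

Lemma subst_coord_form h z k : subst_coord h z (coord_form k) = z k.
Proof.
rewrite raddf_sum /=.
under eq_bigr do rewrite subst_coordZ /subst_coord mmapX mmap1U mulr_sumr.
rewrite exchange_big /= (bigD1 k) //= -[RHS]addr0; congr (_ + _).
  under eq_bigr do rewrite mulrA -rmorphM mulrC.
  rewrite -mulr_sumr -raddf_sum /=; have := mulmxV Bu => /matrixP/(_ k k).
  rewrite !mxE eqxx; under eq_bigr do rewrite mulrC.
  by move=> ->; rewrite rmorph1 mulr1.
rewrite big1 // => j ji; under eq_bigr do rewrite mulrA -rmorphM mulrC.
rewrite -mulr_sumr -raddf_sum /=; have := mulmxV Bu => /matrixP/(_ j k).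
rewrite !mxE (negbTE ji); under eq_bigr do rewrite mulrC.
by move=> ->; rewrite rmorph0 mulr0.
Qed.

End Coordinates.

(** * Substitutions as reduction modulo linear forms and as restriction to subspaces *)

Section Substitution.
Variables (n : nat).

(** The polynomials congruent to their image modulo the [y k - z k] are closed under sums and
    products and contain the constants and the [y k], hence the variables. *)
Lemma subst_coord_congr (F : fieldType) (B : 'M[F]_n) (Bu : B \in unitmx)
    (z : 'I_n -> {mpoly F[n]}) p :
  exists c : 'I_n -> {mpoly F[n]},
    p - subst_coord B (@mpolyC n F) z p = \sum_k c k * (coord_form B k - z k).
Proof.
pose s : {rmorphism _ -> _} := subst_coord B (@mpolyC n F) z; pose y := coord_form B.
rewrite -[subst_coord _ _ _]/(s : _ -> _) -/y.
pose P p := exists c : 'I_n -> {mpoly F[n]}, p - s p = \sum_k c k * (y k - z k).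
have PD q r : P q -> P r -> P (q + r).
  move=> [c Hc] [d Hd]; exists (fun k => c k + d k).
  under eq_bigr do rewrite mulrDl.
  by rewrite big_split /= -Hc -Hd rmorphD opprD addrACA.
have PM q r : P q -> P r -> P (q * r).
  (* This is [q * r - s q * s r = r * (q - s q) + s q * (r - s r)]. *)
  move=> [c Hc] [d Hd]; exists (fun k => r * c k + s q * d k).
  under eq_bigr do rewrite mulrDl -!mulrA.
  by rewrite big_split /= -!mulr_sumr -Hc -Hd rmorphM; ring.
have PC a : P a%:MP.
  by exists (fun=> 0); rewrite [s _]subst_coordC subrr big1 // => k _; rewrite mul0r.
have P0 : P 0 by rewrite -mpolyC0; apply: PC.
have P1 : P 1 by rewrite -mpolyC1; apply: PC.
have Py k : P (y k).
  exists (fun l => (l == k)%:R); rewrite [s _]subst_coord_form //.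
  rewrite (bigD1 k) //= eqxx mul1r big1 ?addr0 // => l lk.
  by rewrite (negbTE lk) mul0r.
rewrite -[exists _, _]/(P p); clearbody P; clear -Bu P PD PM PC P0 P1 Py.
have PX i : P 'X_i.
  rewrite [X in P X](mpolyX_coord_form Bu i).
  apply: (@big_ind _ P) => [|//|k _]; first exact: P0.
  by rewrite -mul_mpolyC; apply: PM.
elim/mpolyind: p => [|a m q _ _ Pq]; first exact: P0.
apply: (PD) => //; rewrite -mul_mpolyC; apply: (PM) => //.
rewrite [X in P X]mpolyXE_id; apply: (@big_ind _ P) => [|//|i _]; first exact: P1.
by elim: (m i) => [|k IH]; [exact: P1 | rewrite exprS; apply: PM].
Qed.

Lemma meval_subst_coord (F : fieldType) (B : 'M[F]_n)
    (z : 'I_n -> {mpoly F[n]}) p (v : 'I_n -> F) :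
  (subst_coord B (@mpolyC n F) z p).@[v] =
  p.@[fun i => ((\row_k (z k).@[v]) *m B) 0 i].
Proof.
rewrite /subst_coord {1}/mmap raddf_sum mevalE; apply: eq_bigr => m _ /=.
rewrite mevalM mevalC; congr (_ * _); rewrite rmorph_prod; apply: eq_bigr => i _.
rewrite rmorphXn raddf_sum mxE; congr (_ ^+ _); apply: eq_bigr => k _.
by rewrite /= mevalM mevalC mxE mulrC.
Qed.

Lemma subst_coord_eq0 (F : numFieldType) (B : 'M[F]_n)
    (V : {vspace 'rV[F]_n}) (z : 'I_n -> {mpoly F[n]}) p k :
  B \in unitmx -> z k != 0 ->
  (forall v : 'rV_n, v != 0 -> v \in V -> p.@[fun i => v 0 i] = 0) ->
  (forall v : 'rV_n, (\row_k (z k).@[fun i => v 0 i]) *m B \in V) ->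
  subst_coord B (@mpolyC n F) z p = 0.
Proof.
(* Nothing is assumed about [p] at the zero vector; the factor [z k] vanishes wherever the
   parametrization [z] reaches it. *)
move=> Bu zk0 pV zV; apply/eqP; rewrite -(mulrI_eq0 _ (mulfI zk0)); apply/eqP.
apply: mpoly_eq0_of_meval => v; rewrite mevalM meval_subst_coord.
have [->|zv] := eqVneq (z k).@[fun i => v 0 i] 0; first by rewrite mul0r.
rewrite pV ?mulr0 //; apply: contra zv => /eqP /(congr1 (mulmx^~ (invmx B))).
by rewrite mulmxK // mul0mx => /rowP/(_ k); rewrite !mxE => /eqP.
Qed.

Lemma subst_coord_poly_homog (F : fieldType) (B : 'M[F]_n) (c : 'I_n -> F)
    d (p : {mpoly F[n]}) :
  p \is d.-homog ->
  exists a, subst_coord B (@polyC F) (fun k => (c k)%:P * 'X) p = a%:P * 'X^d.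
Proof.
move=> /dhomogP pd; rewrite /subst_coord /mmap big_seq.
apply: (big_ind (fun q => exists a, q = a%:P * 'X^d)) => [|q r [a ->] [b ->]|m mp].
- by exists 0; rewrite mul0r.
- by exists (a + b); rewrite polyCD mulrDl.
exists (p@_m * \prod_i (\sum_k B k i * c k) ^+ m i).
rewrite polyCM -mulrA; congr (_ * _); rewrite -(pd m mp) /mmap1 /= mdegE.
rewrite -prodrXr rmorph_prod -big_split; apply: eq_bigr => i _ /=.
under eq_bigr do rewrite mulrA -polyCM.
by rewrite -mulr_suml -raddf_sum exprMn rmorphXn.
Qed.

End Substitution.

(** * Minimal generating subsets, and generators for the ideal of three lines in coordinates *)

Section IdealGenerators.
Variable A : comNzRingType.

Lemma mem_ideal_gen (G : set A) x : G x -> ideal_gen G x.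
Proof.
by exists 1%N, (fun=> 1), (fun=> x); rewrite big_ord1 mul1r.
Qed.

Lemma ideal_gen_sub (G H : set A) : G `<=` ideal_gen H -> ideal_gen G `<=` ideal_gen H.
Proof.
move=> GH _ [k [c [g [Gg ->]]]]; apply: (big_ind (ideal_gen H)) => [|x y|i _].
- exact: ideal_gen0.
- exact: ideal_genD.
- exact/ideal_genM/GH.
Qed.

(** Redundant elements are removed one at a time, by induction on the size; a list without redundant
    elements is minimal. *)
Lemma minimal_generating_subset (s : seq A) : exists t : seq A,
  [/\ {subset t <= s}, ideal_gen [set` t] = ideal_gen [set` s]
    & forall H : set A, H `<=` [set` t] -> ideal_gen H = ideal_gen [set` s] ->
        H = [set` t]].
Proof.
have [k le_k] := ubnP (size s); elim: k => // k IH in s le_k *.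
have [[x xs xE]|irr] := pselect (exists2 x, x \in s &
    ideal_gen [set` filter (predC1 x) s] = ideal_gen [set` s]).
  have [|t [ts tE tmin]] := IH (filter (predC1 x) s).
    rewrite -ltnS; apply: leq_trans le_k; rewrite ltnS size_filter.
    by rewrite -(count_predC (predC1 x) s) -addn1 leq_add2l -has_count;
      apply/hasP; exists x => //=; rewrite eqxx.
  exists t; split=> [y /ts||H Ht]; first by rewrite mem_filter => /andP[].
    by rewrite tE.
  by rewrite -xE; apply: tmin.
exists s; split=> // H Hs HE; apply/seteqP; split=> // x xs.
apply: contrapT => Hx; apply: irr; exists x => //; apply/seteqP; split.
  by apply: ideal_gen_sub => y /=; rewrite mem_filter => /andP[_ ys]; apply: mem_ideal_gen.
rewrite -HE; apply: ideal_gen_sub => y Hy; apply: mem_ideal_gen => /=.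
rewrite mem_filter (Hs _ Hy) andbT; apply/eqP => yx; apply: Hx.
by rewrite -yx.
Qed.

End IdealGenerators.

(* Ideal membership in [(y2,y3,y4)], then in [(y0,y1,y4)], then in
   [(y1,y3,y2-y0)] is tested by the retractions [s1], [s2], [s3]. *)
Lemma three_lines_generators (A : idomainType) (y0 y1 y2 y3 y4 : A)
    (s1 s2 s3 s4 : {rmorphism A -> A}) (p : A) :
  (forall x, exists a b c, x - s1 x = a * y2 + b * y3 + c * y4) ->
  (forall x, exists a b c, x - s2 x = a * y0 + b * y1 + c * y4) ->
  (forall x, exists a b c, x - s3 x = a * y1 + b * y3 + c * (y2 - y0)) ->
  (forall x, exists a, x - s4 x = a * y4) ->
  s2 y2 = y2 -> s2 y3 = y3 -> s2 y4 = 0 ->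
  s3 y0 = y0 -> s3 y1 = 0 -> s3 y2 = y0 -> s3 y3 = 0 -> s3 y4 = y4 ->
  s4 y0 = y0 -> s4 y4 = 0 -> y0 != 0 ->
  s1 p = 0 -> s2 p = 0 -> s3 p = 0 ->
  exists c1 c2 c3 c4 c5 c6 c7, p =
    c1 * (y4 * y1) + c2 * (y4 * y3) + c3 * (y4 * (y0 - y2)) + c4 * (y0 * y3) +
    c5 * (y1 * y2) + c6 * (y1 * y3) + c7 * (y0 * (y2 * (y0 - y2))).
Proof.
move=> H1 H2 H3 H4 s22 s23 s24 s30 s31 s32 s33 s34 s40 s44 y0n0 p1 p2 p3.
have [a [b [c]]] := H1 p; rewrite p1 subr0 => pE.
have [a0 [a1 [a4 /eqP]]] := H2 a; rewrite subr_eq => /eqP aE.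
have [b0 [b1 [b4 /eqP]]] := H2 b; rewrite subr_eq => /eqP bE.
(* The remainders of [a] and [b] modulo [(y0, y1, y4)] need not vanish, but their total contribution
   to [p] does, by [s2 p = 0]. *)
have E2 : s2 a * y2 + s2 b * y3 = 0.
  by move: p2; rewrite pE !rmorphD !rmorphM s22 s23 s24 mulr0 addr0.
set C := a4 * y2 + b4 * y3 + c.
have {}pE : p = a0 * (y0 * y2) + y4 * C + a1 * (y1 * y2) + b0 * (y0 * y3) +
    b1 * (y1 * y3).
  transitivity (p - (s2 a * y2 + s2 b * y3)); first by rewrite E2 subr0.
  by rewrite pE /C [X in X * y2 + _]aE [X in _ + X * y3 + _]bE; ring.
(* Only these two terms of [p] survive under [s3]. Setting [y4] to 0 by [s4] then shows that [y4]
   divides [s3 a0]. *)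
have E3 : y4 * s3 C = - (s3 a0 * (y0 * y0)).
  move: p3; rewrite pE !(rmorphD, rmorphM) s30 s31 s32 s33 s34.
  by rewrite !(mul0r, mulr0, addr0) => /eqP; rewrite addrC addr_eq0 => /eqP.
have s4a : s4 (s3 a0) = 0.
  have /eqP := congr1 s4 E3; rewrite rmorphM s44 mul0r rmorphN !rmorphM s40.
  by rewrite eq_sym oppr_eq0 !mulf_eq0 (negbTE y0n0) !orbF => /eqP.
have [d] := H4 (s3 a0); rewrite s4a subr0 => dE.
have [e1 [e3 [e /eqP]]] := H3 a0; rewrite subr_eq => /eqP a0E.
have [f1 [f3 [f /eqP]]] := H3 C; rewrite subr_eq => /eqP CE.
(* The cubic comes from the multiple of [y2 - y0] in [a0]. The remainders of [a0] and [C] under [s3]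
   combine to [d * y4 * y0 * (y2 - y0)], whence [- d * y0]. *)
exists f1, f3, (- f - d * y0), (b0 + y2 * e3), (a1 + y0 * e1), b1, (- e).
rewrite pE CE mulrDr E3 dE a0E dE; ring.
Qed.

(** * An obstruction to a linear resolution of the residue field *)

Section LinearSyzygies.
Variables (F : fieldType) (n m : nat) (M : 'I_m.+1 -> line F n).
Variable rho : {rmorphism {mpoly F[n.+1]} -> {poly F}}.
Hypothesis rho_homog : forall d p, p \is d.-homog ->
  exists a, rho p = a%:P * 'X^d.
Hypothesis rho_ideal : forall p, p \in defining_ideal M -> 'X^3 %| rho p.

Local Notation A := (coordinate_ring M).
Local Notation piA := (\pi_{ideal_quot defining_ideal M}).

(** The image is a scalar times ['X^2], yet divisible by ['X^3]. *)
Lemma rho_quadric_eq0 p : p \in defining_ideal M -> p \is 2.-homog -> rho p = 0.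
Proof.
move=> /rho_ideal + /rho_homog[a aE]; rewrite aE => /dvdpP[r rE].
have := congr1 (fun r : {poly F} => r`_2) rE.
by rewrite coefMXn /= coefMXn /= coefC /= => ->; rewrite polyC0 mul0r.
Qed.

(* In a linear resolution [q] times a lift of the syzygy given by [y] is a
   combination of quadratic relations, which [rho] kills; so the cubic relation
   [y * q] has to vanish under [rho]. *)
Lemma koszul_cubic_rho (y q : {mpoly F[n.+1]}) c :
  y \is 1.-homog -> q \is 2.-homog -> y * q \in defining_ideal M ->
  rho (y * q) = c%:P * 'X^3 -> koszul (coordinate_grading M) -> c = 0.
Proof.
move=> y1 q2 yqJ rhoyq [b [e [d [dgr aug ex0 ex]]]].
have piJ p r : piA p = piA r -> p - r \in defining_ideal M.
  by move=> /eqP; rewrite -Quotient.idealrBE.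
have repr_pi (x : A) : piA (repr x) = x by exact: reprK.
have gr_dvd k p : p \is k.-homog -> 'X^k %| rho p.
  by move=> /rho_homog[a ->]; apply: dvdp_mull.
have irr_lift (x : A) : irrelevant_ideal (coordinate_grading M) x ->
    exists2 p, piA p = x & 'X %| rho p.
  move=> [k [u [g [gg ->]]]]; apply: (big_ind (fun x => exists2 p, piA p = x & 'X %| rho p)).
  - by exists 0; rewrite ?rmorph0 ?dvdp0.
  - move=> _ _ [p <- Xp] [r <- Xr].
    by exists (p + r); rewrite rmorphD // dvdp_add.
  move=> i _; have [k' /= k'0 [p pk ->]] := gg i.
  exists (repr (u i) * p); first by rewrite rmorphM /= repr_pi.
  rewrite rmorphM dvdp_mull // (dvdp_trans _ (gr_dvd _ _ pk)) //.
  by rewrite -[X in X %| _]expr1 dvdp_exp2l.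
have irr_y (x : A) : irrelevant_ideal (coordinate_grading M) (piA y * x).
  rewrite mulrC; apply/ideal_genM/mem_ideal_gen; exists 1%N => //.
  by exists y.
have yq0 : piA y * piA q = 0.
  rewrite -[LHS](rmorphM piA) -[RHS](rmorph0 piA); apply/eqP.
  by rewrite -Quotient.idealrBE subr0.
(* [v0] lifts 1 through the augmentation. Then [y * v0] lies in its kernel, so it equals [w *m d 0];
   as [y * q = 0] in the quotient, [q * w] is a syzygy and equals [u *m d 1]. *)
have [v0 v0E] := aug 1.
have [|w wE] := (ex0 (piA y *: v0)).1; first by rewrite -scalemxAl mxE; apply: irr_y.
have [|u uE] := (ex 0%N (piA q *: w)).1.
  by rewrite -scalemxAl -wE scalerA [piA q * _]mulrC yq0 scale0r.
have dd k l : \sum_j d 1%N k j * d 0%N j l = 0.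
  have := (ex 0%N (row k (d 1%N))).2 (ex_intro _ (delta_mx 0 k) (rowE _ _)).
  move=> /rowP/(_ l); rewrite !mxE => dkl; rewrite -[RHS]dkl.
  by apply: eq_bigr => j _; rewrite mxE.
have /choice[D1 D1P] : forall kj, exists p : {mpoly F[n.+1]},
    p \is 1.-homog /\ d 1%N kj.1 kj.2 = piA p.
  by move=> [k j]; have [p] := dgr 1%N k j; exists p.
have /choice[D0 D0P] : forall kj, exists p : {mpoly F[n.+1]},
    p \is 1.-homog /\ d 0%N kj.1 kj.2 = piA p.
  by move=> [k j]; have [p] := dgr 0%N k j; exists p.
(* For nonzero [c] all entries of [v0] would have lifts whose image under [rho] is divisible by
   ['X], which is incompatible with [v0] lifting 1. *)
have V0 l : c != 0 -> 'X %| rho (repr (v0 0 l)).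
  move=> c0; set V := repr (v0 0 l); pose W j := repr (w 0 j); pose U k := repr (u 0 k).
  have hJ : y * V - \sum_j W j * D0 (j, l) \in defining_ideal M.
    apply: piJ; rewrite rmorphM raddf_sum /= repr_pi.
    move/rowP/(_ l): wE; rewrite !mxE => ->; apply: eq_bigr => j _.
    by rewrite rmorphM /= repr_pi (D0P (j, l)).2.
  have gJ j : q * W j - \sum_k U k * D1 (k, j) \in defining_ideal M.
    apply: piJ; rewrite rmorphM raddf_sum /= repr_pi.
    move/rowP/(_ j): uE; rewrite !mxE => ->; apply: eq_bigr => k _.
    by rewrite rmorphM /= repr_pi (D1P (k, j)).2.
  have Q0 k : rho (\sum_j D1 (k, j) * D0 (j, l)) = 0.
    apply: rho_quadric_eq0; last first.
      by apply: rpred_sum => j _; rewrite (@dhomogM _ _ _ 1%N _ 1%N)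
        ?(D1P (k, j)).1 ?(D0P (j, l)).1.
    rewrite -[X in X \in _]subr0; apply: piJ; rewrite rmorph0 -[RHS](dd k l) raddf_sum.
    by apply: eq_bigr => j _; rewrite /= rmorphM /= (D1P (k, j)).2 (D0P (j, l)).2.
  (* The first two sums have order at least 4 under [rho]: an element of the ideal gives ['X^3], and
     [q] or an entry of [D0] gives another ['X]. The last sum vanishes by [Q0]. *)
  have E : y * q * V = q * (y * V - \sum_j W j * D0 (j, l)) +
      \sum_j (q * W j - \sum_k U k * D1 (k, j)) * D0 (j, l) +
      \sum_k U k * \sum_j D1 (k, j) * D0 (j, l).
    rewrite (_ : \sum_j _ * D0 (j, l) = q * (\sum_j W j * D0 (j, l)) -
      \sum_k U k * \sum_j D1 (k, j) * D0 (j, l)); first by ring.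
    under eq_bigr do rewrite mulrBl mulr_suml.
    rewrite sumrB exchange_big mulr_sumr /=; congr (_ - _); apply: eq_bigr => k _.
      by rewrite mulrA.
    by rewrite mulr_sumr; apply: eq_bigr => j _; rewrite mulrA.
  have : 'X^4 %| rho (y * q * V).
    rewrite E !rmorphD; apply: dvdp_add; first apply: dvdp_add.
    - rewrite rmorphM (exprD _ 1 3) dvdp_mul ?rho_ideal //.
      by rewrite (dvdp_trans _ (gr_dvd _ _ q2)) // dvdp_exp2l.
    - rewrite raddf_sum; apply: (big_ind (fun r => 'X^4 %| r)) => [|a a'|j _].
      + exact: dvdp0.
      + exact: dvdp_add.
      by rewrite /= rmorphM (exprD _ 3 1) dvdp_mul ?rho_ideal ?gr_dvd ?(D0P (j, l)).1.
    rewrite raddf_sum big1 ?dvdp0 // => k _.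
    by rewrite /= rmorphM Q0 mulr0.
  rewrite rmorphM rhoyq -mulrA (exprD _ 3 1) mulrCA dvdp_mul2l; last first.
    by rewrite expf_neq0 ?polyX_eq0.
  by rewrite mul_polyC dvdpZr // expr1.
have [p pE Xp] := irr_lift _ v0E.
apply/eqP/negPn/negP => c0.
(* Under [rho] this element of the ideal, the sum and [p] are all divisible by ['X], so 1 would be
   too. *)
have : 1 - \sum_l repr (v0 0 l) * repr (e l 0) - p \in defining_ideal M.
  apply: piJ; rewrite pE rmorphB rmorph1 raddf_sum mxE; congr (_ - _).
  by apply: eq_bigr => l _; rewrite /= rmorphM /= !repr_pi.
move=> /rho_ideal; rewrite !rmorphB rmorph1 raddf_sum => H.
have {H} : 'X %| 1 - \sum_l rho (repr (v0 0 l) * repr (e l 0)) - rho p.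
  by apply: dvdp_trans H; rewrite -[X in X %| _]expr1 dvdp_exp2l.
rewrite dvdp_subl // dvdp_subl.
  by rewrite dvdp1 size_polyX.
apply: (big_ind (fun r => 'X %| r)) => [|a a'|l _].
- exact: dvdp0.
- exact: dvdp_add.
by rewrite rmorphM dvdp_mulr ?V0.
Qed.

End LinearSyzygies.

(** * Normal form of three lines in general linear position *)

Lemma sum_ord5 (V : nmodType) (f : 'I_5 -> V) :
  \sum_i f i = f (inord 0) + f (inord 1) + f (inord 2) + f (inord 3) + f (inord 4).
Proof.
rewrite !big_ord_recl big_ord0 addr0 !addrA.
by congr (f _ + f _ + f _ + f _ + f _); apply/val_inj; rewrite /= inordK.
Qed.

Lemma plane_basis (K : fieldType) (vT : vectType K) (V : {vspace vT}) a :
  \dim V = 2%N -> a \in V -> a != 0 -> exists c, V = (<[a]> + <[c]>)%VS.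
Proof.
move=> dV aV a0; have aVs : (<[a]> <= V)%VS by [].
have da : \dim <[a]> = 1%N by rewrite dim_vline a0.
have dD : \dim (V :\: <[a]>) = 1%N.
  by have := dimv_cap_compl V <[a]>; rewrite (capv_idPr aVs) da dV => -[].
exists (vpick (V :\: <[a]>)); rewrite -[LHS](addv_diff_cap V <[a]>) addvC.
rewrite (capv_idPr aVs); congr (_ + _)%VS; apply/eqP.
by rewrite eq_sym eqEdim -memvE memv_pick dD dim_vline vpick0 -dimv_eq0 dD.
Qed.

(* The third line meets the span of the first two, which yields the basis
   [e0, e1, e2, e3, e4] (the rows of [B]) for which the lines are [<e0, e1>],
   [<e2, e3>] and [<e0 + e2, e4>]. *)
Lemma three_lines_basis (F : fieldType) (M : 'I_3 -> line F 4) :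
  general_linear_position M ->
  exists2 B : 'M[F]_5, B \in unitmx & forall x : 'rV_5,
    [/\ (x *m B \in line_space (M (inord 0))) =
          [&& x 0 (inord 2) == 0, x 0 (inord 3) == 0 & x 0 (inord 4) == 0],
        (x *m B \in line_space (M (inord 1))) =
          [&& x 0 (inord 0) == 0, x 0 (inord 1) == 0 & x 0 (inord 4) == 0]
      & (x *m B \in line_space (M (inord 2))) =
          [&& x 0 (inord 1) == 0, x 0 (inord 3) == 0 &
              x 0 (inord 2) == x 0 (inord 0)]].
Proof.
move=> hM.
(* Two of the lines span a 3-space, so they are disjoint ([capD]); all three span the ambient space
   ([dimT]). *)
have dimD (i j : 'I_3) : i != j -> \dim (M i + M j) = 4%N.
  move=> ij; have := hM (i |: [set j])%SET; rewrite cards2 ij.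
  rewrite big_setU1 ?big_set1 ?inE //=; apply.
  by apply/set0Pn; exists i; rewrite !inE eqxx.
have capD (i j : 'I_3) v : i != j -> v \in line_space (M i) ->
    v \in line_space (M j) -> v = 0.
  move=> ij vi vj; apply/eqP; rewrite -memv0.
  suff /eqP <- : (M i :&: M j)%VS == 0%VS by rewrite memv_cap vi.
  rewrite -dimv_eq0; have := dimv_sum_cap (M i) (M j).
  by rewrite dimD // !dim_line => /eqP; rewrite -[X in _ == X]addn0 eqn_add2l.
have ne (i j : nat) : (i < 3)%N -> (j < 3)%N -> i != j -> inord i != inord j :> 'I_3.
  by move=> i3 j3; apply: contra => /eqP/(congr1 val); rewrite /= !inordK // => ->.
set V0 := line_space (M (inord 0)); set V1 := line_space (M (inord 1)).
set V2 := line_space (M (inord 2)).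
have dimT : \dim (V0 + V1 + V2) = 5%N.
  have <- : (\sum_(i in [set: 'I_3]%SET) line_space (M i) = V0 + V1 + V2)%VS.
    rewrite big_mkcond !big_ord_recl big_ord0 /= !inE addv0 addvA.
    by congr (line_space (M _) + line_space (M _) + line_space (M _))%VS;
      apply/val_inj; rewrite /= inordK.
  by rewrite hM ?cardsT ?card_ord //; apply/set0Pn; exists ord0; rewrite inE.
(* The intersection has dimension 4 + 2 - 5 = 1. Both components [a] and [b] of [w] are nonzero,
   since otherwise [w] would lie on two of the lines. *)
set w := vpick ((V0 + V1) :&: V2)%VS.
have w0 : w != 0.
  rewrite vpick0 -dimv_eq0; have := dimv_sum_cap (V0 + V1) V2.
  by rewrite dimT dimD ?ne // dim_line; case: (\dim _).
have /memv_capP[/memv_addP[a aV [b bV wE]] wV] := memv_pick ((V0 + V1) :&: V2).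
rewrite -/w in wE wV.
have a0 : a != 0.
  by apply: contra w0 => /eqP a0; rewrite (capD (inord 1) (inord 2) w) ?ne // wE a0 add0r.
have b0 : b != 0.
  by apply: contra w0 => /eqP b0; rewrite (capD (inord 0) (inord 2) w) ?ne // wE b0 addr0.
have [c V0E] := plane_basis (dim_line _) aV a0.
have [g V1E] := plane_basis (dim_line _) bV b0.
have [h V2E] := plane_basis (dim_line _) wV w0.
rewrite -/V0 in V0E; rewrite -/V1 in V1E; rewrite -/V2 in V2E.
pose X := [tuple a; c; b; g; h].
(* The five vectors span the sum of the three lines, which has dimension 5. *)
have XT : free X.
  have sX v : v \in X -> v \in <<X>>%VS by exact: memv_span.
  have sVX : (V0 + V1 + V2 <= <<X>>)%VS.
    rewrite V0E V1E V2E !subv_add -!memvE.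
    by rewrite wE memvD !sX // !inE eqxx ?orbT.
  rewrite /free eqn_leq dim_span; apply: leq_trans (dimvS sVX).
  by rewrite dimT.
pose B := \matrix_(k < 5) X`_k.
have mulB x : x *m B = x 0 (inord 0) *: a + x 0 (inord 1) *: c +
    x 0 (inord 2) *: b + x 0 (inord 3) *: g + x 0 (inord 4) *: h.
  by rewrite mulmx_sum_row sum_ord5 !rowK !inordK.
have Bu : B \in unitmx.
  rewrite -row_free_unit; apply: inj_row_free => x xB.
  apply/rowP => k; rewrite mxE; move/freeP: XT => /(_ (x 0)); apply.
  by rewrite -[RHS]xB mulmx_sum_row; apply: eq_bigr => i _; rewrite rowK.
pose vec (s : seq F) : 'rV_5 := \row_(k < 5) s`_k.
have vecE s k : (k < 5)%N -> vec s 0 (inord k) = s`_k.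
  by move=> k5; rewrite mxE inordK.
have eq_vec x s : x *m B = vec s *m B -> forall k, (k < 5)%N -> x 0 (inord k) = s`_k.
  move=> /(congr1 (mulmx^~ (invmx B))); rewrite !mulmxK // => -> k k5.
  exact: vecE.
exists B => // x; split.
- rewrite -/V0 V0E; apply/idP/and3P => [|[/eqP x2 /eqP x3 /eqP x4]]; last first.
    rewrite mulB x2 x3 x4 !scale0r !addr0.
    by rewrite memv_add // memvZ // memv_line.
  case/memv_addP => _ /vlineP[s ->] [_ /vlineP[t ->] E].
  have {}E : x *m B = vec [:: s; t; 0; 0; 0] *m B.
    by rewrite E mulB !vecE //= !scale0r !addr0.
  by rewrite !(eq_vec _ _ E) /= ?eqxx.
- rewrite -/V1 V1E; apply/idP/and3P => [|[/eqP x2 /eqP x3 /eqP x4]]; last first.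
    rewrite mulB x2 x3 x4 !scale0r !addr0 !add0r.
    by rewrite memv_add // memvZ // memv_line.
  case/memv_addP => _ /vlineP[s ->] [_ /vlineP[t ->] E].
  have {}E : x *m B = vec [:: 0; 0; s; t; 0] *m B.
    by rewrite E mulB !vecE //= !scale0r !addr0 !add0r.
  by rewrite !(eq_vec _ _ E) /= ?eqxx.
rewrite -/V2 V2E wE; apply/idP/and3P => [|[/eqP x2 /eqP x3 /eqP x4]]; last first.
  rewrite mulB x2 x3 x4 !scale0r !addr0 -scalerDr.
  by rewrite memv_add // memvZ // memv_line.
case/memv_addP => _ /vlineP[s ->] [_ /vlineP[t ->] E].
have {}E : x *m B = vec [:: s; 0; s; 0; t] *m B.
  by rewrite E mulB !vecE //= !scale0r !addr0 scalerDr.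
by rewrite !(eq_vec _ _ E) /= ?eqxx.
Qed.

(** * The seven generators, and the two conclusions for lines in normal form *)

Section ThreeLines.
Variables (F : numFieldType) (M : 'I_3 -> line F 4) (B : 'M[F]_5).
Hypothesis Bu : B \in unitmx.
Hypothesis BM : forall x : 'rV_5,
    [/\ (x *m B \in line_space (M (inord 0))) =
          [&& x 0 (inord 2) == 0, x 0 (inord 3) == 0 & x 0 (inord 4) == 0],
        (x *m B \in line_space (M (inord 1))) =
          [&& x 0 (inord 0) == 0, x 0 (inord 1) == 0 & x 0 (inord 4) == 0]
      & (x *m B \in line_space (M (inord 2))) =
          [&& x 0 (inord 1) == 0, x 0 (inord 3) == 0 &
              x 0 (inord 2) == x 0 (inord 0)]].

Local Notation y k := (coord_form B (inord k)).

Definition three_lines_quadrics : seq {mpoly F[5]} :=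
  [:: y 4 * y 1; y 4 * y 3; y 4 * (y 0 - y 2); y 0 * y 3; y 1 * y 2; y 1 * y 3].

Definition three_lines_cubic : {mpoly F[5]} := y 0 * (y 2 * (y 0 - y 2)).

Lemma quadrics_homog p : p \in three_lines_quadrics -> p \is 2.-homog.
Proof.
rewrite !inE => /or4P[|||/or3P[]] /eqP ->; rewrite (@dhomogM _ _ _ 1%N _ 1%N) //;
  by rewrite ?rpredB ?coord_form_homog.
Qed.

Lemma cubic_homog : three_lines_cubic \is 3.-homog.
Proof.
by rewrite (@dhomogM _ _ _ 1%N _ 2%N) ?(@dhomogM _ _ _ 1%N _ 1%N) ?rpredB ?coord_form_homog.
Qed.

Lemma homog_line_ideal (L : line F 4) l p : l \is 1.-homog ->
  (forall x : 'rV_5, x *m B \in line_space L -> l.@[fun i => (x *m B) 0 i] = 0) ->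
  line_ideal L (p * l).
Proof.
move=> l1 lL; apply/ideal_genM/mem_ideal_gen; split; first by exists 1%N.
by move=> v _; rewrite -[v](mulmxKV Bu); apply: lL.
Qed.

Lemma line_ideal_coord :
  [/\ forall k p, k \in [:: 2; 3; 4]%N -> line_ideal (M (inord 0)) (p * y k),
      forall k p, k \in [:: 0; 1; 4]%N -> line_ideal (M (inord 1)) (p * y k),
      forall k p, k \in [:: 1; 3]%N -> line_ideal (M (inord 2)) (p * y k)
    & forall p, line_ideal (M (inord 2)) (p * (y 0 - y 2))].
Proof.
split=> [k p|k p|k p|p].
- rewrite !inE => kE; apply: homog_line_ideal; first exact: coord_form_homog.
  move=> x; case: (BM x) => -> _ _ /and3P[/eqP ? /eqP ? /eqP ?].
  by rewrite meval_coord_form //; case/or3P: kE => /eqP ->.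
- rewrite !inE => kE; apply: homog_line_ideal; first exact: coord_form_homog.
  move=> x; case: (BM x) => _ -> _ /and3P[/eqP ? /eqP ? /eqP ?].
  by rewrite meval_coord_form //; case/or3P: kE => /eqP ->.
- rewrite !inE => kE; apply: homog_line_ideal; first exact: coord_form_homog.
  move=> x; case: (BM x) => _ _ -> /and3P[/eqP ? /eqP ? /eqP ?].
  by rewrite meval_coord_form //; case/orP: kE => /eqP ->.
apply: homog_line_ideal; first by rewrite rpredB ?coord_form_homog.
move=> x; case: (BM x) => _ _ -> /and3P[/eqP ? /eqP ? /eqP E].
by rewrite mevalB !meval_coord_form // E subrr.
Qed.

Lemma generators_in_ideal p : p \in three_lines_cubic :: three_lines_quadrics ->
  p \in defining_ideal M.
Proof.
have [L0 L1 L2 L2'] := line_ideal_coord.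
move=> pg; apply/asboolP => i; move: pg.
have [->|->|->] : [\/ i = inord 0, i = inord 1 | i = inord 2].
  case: i => [[|[|[|//]]] i3]; [apply: Or31|apply: Or32|apply: Or33];
    by apply/val_inj; rewrite /= inordK.
(* For each line every generator has a linear factor vanishing on it; the alternatives below move
   that factor to the end of the product. *)
all: rewrite !inE ?/three_lines_cubic; case/orP=> [|/or4P[|||/or3P[]]] /eqP ->.
all: first [ by [apply: L0|apply: L1|apply: L2|apply: L2']
  | by rewrite mulrC; first [apply: L0|apply: L1|apply: L2]
  | by rewrite mulrCA mulrC; apply: L0
  | by rewrite mulrA; apply: L2' ].
Qed.

Local Notation subst z := (subst_coord B (@mpolyC 5 F) (fun k => nth 0 z k)).

Lemma coord_form_neq0 k : coord_form B k != 0.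
Proof.
apply/eqP => /(congr1 (meval (fun i => ((delta_mx 0 k : 'rV_5) *m B) 0 i))) /eqP.
by rewrite meval_coord_form // meval0 mxE !eqxx oner_eq0.
Qed.

Lemma substE z k : (k < 5)%N -> subst z (y k) = nth 0 z k.
Proof. by move=> k5; rewrite subst_coord_form // inordK. Qed.

Lemma subst_congr z p : exists c : nat -> {mpoly F[5]}, p - subst z p =
  c 0 * (y 0 - nth 0 z 0) + c 1 * (y 1 - nth 0 z 1) + c 2 * (y 2 - nth 0 z 2) +
  c 3 * (y 3 - nth 0 z 3) + c 4 * (y 4 - nth 0 z 4).
Proof.
have [c ->] := subst_coord_congr Bu (fun k => nth 0 z k) p.
by exists (fun k => c (inord k)); rewrite sum_ord5 !inordK.
Qed.

Lemma subst_line_eq0 (i : 'I_3) (z : seq {mpoly F[5]}) k p :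
  p \in defining_ideal M -> (k < 5)%N -> nth 0 z k = y k ->
  (forall v : 'rV_5, (\row_(j < 5) (nth 0 z j).@[fun i => v 0 i]) *m B \in
     line_space (M i)) ->
  subst z p = 0.
Proof.
move=> /asboolP/(_ i)/line_ideal_vanishes pi k5 zk zV.
apply: (@subst_coord_eq0 _ _ _ (M i) _ _ (inord k)) => //.
by rewrite inordK // zk coord_form_neq0.
Qed.

Lemma defining_idealE :
  [set` defining_ideal M] =
  ideal_gen [set` three_lines_cubic :: three_lines_quadrics].
Proof.
apply/seteqP; split=> [p /= pJ|p]; last first.
  move=> [k [c [g [gG ->]]]] /=; apply: rpred_sum => i _.
  exact/idealMr/generators_in_ideal/gG.
have mv0 v : (0 : {mpoly F[5]}).@[v] = 0 by exact: meval0.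
(* The first three substitutions parametrize the three lines in dual coordinates, so they kill [p];
   the fourth sets [y 4] to 0. *)
have [||||||||||||||||||c1 [c2 [c3 [c4 [c5 [c6 [c7 ->]]]]]]] :=
  @three_lines_generators {mpoly F[5]} (y 0) (y 1) (y 2) (y 3) (y 4)
    (subst [:: y 0; y 1; 0; 0; 0]) (subst [:: 0; 0; y 2; y 3; 0])
    (subst [:: y 0; 0; y 0; 0; y 4]) (subst [:: y 0; y 1; y 2; y 3; 0]) p.
- move=> x; have [c ->] := subst_congr [:: y 0; y 1; 0; 0; 0] x.
  by exists (c 2), (c 3), (c 4); rewrite /= !subrr !mulr0 !subr0 !add0r.
- move=> x; have [c ->] := subst_congr [:: 0; 0; y 2; y 3; 0] x.
  by exists (c 0), (c 1), (c 4); rewrite /= !subrr !mulr0 !subr0 !addr0.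
- move=> x; have [c ->] := subst_congr [:: y 0; 0; y 0; 0; y 4] x.
  exists (c 1), (c 3), (c 2); rewrite /= !subrr !mulr0 !subr0 !add0r addr0.
  by rewrite addrAC.
- move=> x; have [c ->] := subst_congr [:: y 0; y 1; y 2; y 3; 0] x.
  by exists (c 4); rewrite /= !subrr !mulr0 !subr0 !add0r.
- exact: substE.
- exact: substE.
- exact: substE.
- exact: substE.
- exact: substE.
- exact: substE.
- exact: substE.
- exact: substE.
- exact: substE.
- exact: substE.
- exact: coord_form_neq0.
- apply: (@subst_line_eq0 (inord 0) _ 0) => // v.
  by case: (BM (\row_j (nth 0 [:: y 0; y 1; 0; 0; 0] j).@[fun i => v 0 i])) => -> _ _;
    rewrite !mxE !inordK //= !mv0 eqxx.
- apply: (@subst_line_eq0 (inord 1) _ 2) => // v.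
  by case: (BM (\row_j (nth 0 [:: 0; 0; y 2; y 3; 0] j).@[fun i => v 0 i])) => _ -> _;
    rewrite !mxE !inordK //= !mv0 eqxx.
- apply: (@subst_line_eq0 (inord 2) _ 0) => // v.
  by case: (BM (\row_j (nth 0 [:: y 0; 0; y 0; 0; y 4] j).@[fun i => v 0 i])) => _ _ ->;
    rewrite !mxE !inordK //= !mv0 !eqxx.
by do !apply: ideal_genD; apply/ideal_genM/mem_ideal_gen; rewrite /= !inE eqxx ?orbT.
Qed.

(* Restriction to the line spanned by [e0 - e2]: the transversal [<e0, e2>] meets
   the three lines, so the quadrics of the ideal vanish on it. *)
Definition restrict_transversal : {mpoly F[5]} -> {poly F} :=
  subst_coord B (@polyC F) (fun k => (nth 0 [:: 1; 0; -1] k)%:P * 'X).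

HB.instance Definition _ := GRing.RMorphism.on restrict_transversal.

(** The default 0 of [nth] supplies the last two coordinates of [e0 - e2]. *)
Lemma restrict_coord k :
  (k < 5)%N -> restrict_transversal (y k) = (nth 0 [:: 1; 0; -1] k)%:P * 'X.
Proof. by move=> k5; rewrite [LHS]subst_coord_form // inordK. Qed.

Lemma restrict_quadric p : p \in three_lines_quadrics -> restrict_transversal p = 0.
Proof.
rewrite !inE => /or4P[|||/or3P[]] /eqP ->;
  by rewrite rmorphM ?rmorphB /= !restrict_coord //= polyC0 !mul0r ?mulr0.
Qed.

(** The three linear factors take the values 1, -1 and 2 at [e0 - e2]. *)
Lemma restrict_cubic : restrict_transversal three_lines_cubic = (- 2%:R)%:P * 'X^3.
Proof.
rewrite !rmorphM !rmorphB /= !restrict_coord //= polyCN polyC1 polyCN.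
by rewrite -[2%:R]/(1 + 1) polyCD polyC1; ring.
Qed.

Lemma cubic_neq0 : three_lines_cubic != 0.
Proof.
apply/eqP => c0; have /eqP := restrict_cubic; rewrite c0 rmorph0 eq_sym.
by rewrite mulf_eq0 polyC_eq0 oppr_eq0 pnatr_eq0 expf_eq0 polyX_eq0.
Qed.

Lemma restrict_ideal p : p \in defining_ideal M -> 'X^3 %| restrict_transversal p.
Proof.
have := congr1 (fun P : set _ => P p) defining_idealE => /= -> [k [c [g [gG ->]]]].
rewrite raddf_sum; apply: (big_ind (fun r => 'X^3 %| r)) => [|a b|i _].
- exact: dvdp0.
- exact: dvdp_add.
rewrite /= rmorphM dvdp_mull //; have := gG i.
rewrite /= inE => /orP[/eqP->|/restrict_quadric->].
  by rewrite restrict_cubic dvdp_mulIr.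
exact: dvdp0.
Qed.

Lemma cubic_in_minimal_generating_set :
  exists2 G : set {mpoly F[5]},
    minimal_generating_set [set` defining_ideal M] G & G three_lines_cubic.
Proof.
rewrite defining_idealE.
have [t [ts tE tmin]] :=
  minimal_generating_subset (three_lines_cubic :: three_lines_quadrics).
exists [set` t].
  split=> // g /ts; rewrite inE => /orP[/eqP->|/quadrics_homog]; last by exists 2%N.
  by exists 3%N; exact: cubic_homog.
(* Without the cubic, [t] would consist of quadrics, and everything it generates would restrict to
   0. *)
apply: contrapT => /= /negP ct.
have : ideal_gen [set` t] three_lines_cubic.
  by rewrite tE; apply: mem_ideal_gen; rewrite /= inE eqxx.
move=> [k [c [g [gt /(congr1 restrict_transversal)]]]].
rewrite restrict_cubic raddf_sum big1 => [/eqP|i _].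
  by rewrite mulf_eq0 polyC_eq0 oppr_eq0 pnatr_eq0 expf_eq0 polyX_eq0.
have gti : g i \in t by exact: gt.
rewrite /= rmorphM /= (@restrict_quadric (g i)) ?mulr0 //.
by have := ts _ gti; rewrite inE => /orP[/eqP gE|//]; rewrite -gE gti in ct.
Qed.

Lemma three_lines_not_koszul : ~ koszul (coordinate_grading M).
Proof.
move=> K; suff /eqP : - 2%:R = 0 :> F by rewrite oppr_eq0 pnatr_eq0.
(* The cubic is split as the linear form [y 0] times the quadric [y 2 * (y 0 - y 2)]. *)
apply: (koszul_cubic_rho _ restrict_ideal _ _ _ restrict_cubic K).
- by move=> d p; apply: subst_coord_poly_homog.
- exact: coord_form_homog.
- by rewrite (@dhomogM _ _ _ 1%N _ 1%N) ?rpredB ?coord_form_homog.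
- by apply: generators_in_ideal; rewrite inE eqxx.
Qed.

End ThreeLines.

(** * The result over the complex numbers *)

Theorem proposition5p3 (R : realType) (M : 'I_3 -> line R[i] 4)
    (hM : general_linear_position M) :
  (exists (G : set {mpoly R[i][5]}) (f : {mpoly R[i][5]}),
      [/\ minimal_generating_set [set` defining_ideal M] G,
          G f, f != 0 & f \is 3.-homog])
  /\ ~ koszul (coordinate_grading M).
Proof.
have [B Bu BM] := three_lines_basis hM; split; last exact: three_lines_not_koszul Bu BM.
have [G Gmin Gf] := cubic_in_minimal_generating_set Bu BM.
exists G, (three_lines_cubic B); split=> //; last exact: cubic_homog.
exact: cubic_neq0 Bu.
Qed.
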